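(* Let $d\ge 2$. Convex combinations of $d$-variate exchangeable FGM copula parameters are exchangeable FGM copula parameters. That is, for every integer $n\ge 1$, all $(\theta_{m,2},\dots,\theta_{m,d})\in\mathcal{T}_d$, $m\in\{1,\dots,n\}$, and all $\lambda_1,\dots,\lambda_n\ge 0$ with $\lambda_1+\dots+\lambda_n=1$, the vector $(\theta_2,\dots,\theta_d)$ with $\theta_k=\sum_{m=1}^n\lambda_m\theta_{m,k}$, $k\in\{2,\dots,d\}$, belongs to $\mathcal{T}_d$.
   Context: A $d$-variate exchangeable FGM (eFGM) copula with parameters $(\theta_2,\dots,\theta_d)$ is $$C(u_1,\dots,u_d)=\left(\prod_{j=1}^d u_j\right)\left(1+\sum_{k=2}^d\sum_{1\le j_1<\dots<j_k\le d}\theta_k\,\overline{u}_{j_1}\cdots\overline{u}_{j_k}\right),\quad (u_1,\dots,u_d)\in[0,1]^d,$$ with $\overline{u}_j=1-u_j$. The set of admissible parameters (eFGM copula parameters) is $$\mathcal{T}_d=\left\{(\theta_2,\dots,\theta_d)\in\mathbb{R}^{d-1}:\ 1+\sum_{k=2}^d\sum_{1\le j_1<\dots<j_k\le d}\theta_k\,\varepsilon_{j_1}\cdots\varepsilon_{j_k}\ge 0\ \text{ for all } (\varepsilon_1,\dots,\varepsilon_d)\in\{-1,1\}^d\right\}.$$ *)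

(* Defs.v *)
From mathcomp Require Import all_boot all_order all_algebra.
From mathcomp Require Import classical_sets reals.

Set Implicit Arguments.
Unset Strict Implicit.
Unset Printing Implicit Defensive.

Import Order.TTheory GRing.Theory Num.Theory.

Local Open Scope classical_set_scope.
Local Open Scope ring_scope.

(* A vector (theta_2, ..., theta_d) is a row vector of length d - 1 whose
   entry in column k (counted from 0) is theta_(k + 2).  A choice of indices
   j_1 < ... < j_k in {1, ..., d} is a k-element set A of coordinates. The eFGM
   copula with these parameters is
     C(u) = (\prod_j u_j) * efgm_sum theta (fun j => 1 - u_j). *)
Definition efgm_sum (R : realType) (d : nat) (theta : 'rV[R]_d.-1)
    (x : 'I_d -> R) : R :=
  1 + \sum_(k < d.-1) \sum_(A : {set 'I_d} | #|A| == k.+2)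
        theta 0 k * \prod_(j in A) x j.

Definition efgm_params (R : realType) (d : nat) : set 'rV[R]_d.-1 :=
  [set theta | forall eps : 'I_d -> R,
     (forall j, eps j = -1 \/ eps j = 1) -> 0 <= efgm_sum theta eps].

Arguments efgm_params : clear implicits.

(* Main.v *)
(* For fixed eps the constraint function is affine in theta, so it commutes
   with convex combinations, which therefore keep it nonnegative. *)
Require Import Defs.
From mathcomp Require Import all_boot all_order all_algebra.
From mathcomp Require Import classical_sets reals.

Import Order.TTheory GRing.Theory Num.Theory.

Local Open Scope ring_scope.

(** Each sign vector [eps] cuts out a closed half-space of parameters (possibly degenerate), and the
    admissible set is their intersection, hence convex. [efgm_sum_convex] carries this: a constant
    plus a linear form in [theta] respects weights of total 1. *)

Lemma efgm_sum_convex (R : realType) (d n : nat) (theta : 'I_n -> 'rV[R]_d.-1)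
    (lambda : 'I_n -> R) (x : 'I_d -> R) :
  \sum_(m < n) lambda m = 1 ->
  efgm_sum (\row_(k < d.-1) \sum_(m < n) lambda m * theta m 0 k) x =
  \sum_(m < n) lambda m * efgm_sum (theta m) x.
Proof.
move=> hsum; rewrite /efgm_sum.
under [RHS]eq_bigr do rewrite mulrDr mulr1 mulr_sumr.
(* The weights must total 1 to reproduce the constant term; what remains is linear in [theta] and
   compared coefficient by coefficient. *)
rewrite big_split /= hsum exchange_big /=; congr (1 + _).
apply: eq_bigr => k _.
under [RHS]eq_bigr do rewrite mulr_sumr.
rewrite exchange_big /=; apply: eq_bigr => A _.
by rewrite mxE mulr_suml; apply: eq_bigr => m _; rewrite mulrA.
Qed.

Theorem theorem4p1 (R : realType) (d : nat) (hd : (2 <= d)%N)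
    (n : nat) (hn : (1 <= n)%N)
    (theta : 'I_n -> 'rV[R]_d.-1) (htheta : forall m, efgm_params R d (theta m))
    (lambda : 'I_n -> R) (hlambda : forall m, 0 <= lambda m)
    (hsum : \sum_(m < n) lambda m = 1) :
  efgm_params R d (\row_(k < d.-1) \sum_(m < n) lambda m * theta m 0 k).
Proof.
move=> eps heps; rewrite efgm_sum_convex //.
by apply: sumr_ge0 => m _; apply: mulr_ge0 => //; apply: htheta.
Qed.
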